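(* For every $k\in\mathbb{N}$, the graph $K_1\vee\Theta(2,2,2k)$ is enumeratively chromatic-choosable.
   Context: $\Theta(l_1,l_2,l_3)$ denotes two end vertices joined by three internally disjoint paths of lengths $l_1,l_2,l_3$; $K_1\vee H$ is the join of $H$ with a single new vertex adjacent to all vertices of $H$. For a list assignment $L$, $P(H,L)$ is the number of proper $L$-colorings; $P(H,m)$ is the chromatic polynomial, and the list color function $P_\ell(H,m)$ is the minimum of $P(H,L)$ over all assignments $L$ of lists of size $m$. A graph $H$ is enumeratively chromatic-choosable if $P_\ell(H,m)=P(H,m)$ for all integers $m\ge\chi(H)$. *)

(* Defs.v *)
From mathcomp Require Import all_boot.
Set Implicit Arguments. Unset Strict Implicit. Unset Printing Implicit Defensive.

Record graph := Graph { gn : nat; gadj : rel 'I_gn }.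

Definition join1 (H : graph) : graph :=
  @Graph (gn H).+1 (fun x y =>
    match unlift ord0 x, unlift ord0 y with
    | Some a, Some b => gadj a b
    | None, Some _ | Some _, None => true
    | None, None => false
    end).

(* Theta(l1,l2,l3): end vertices 0 and 1; the internal vertices of the i-th
   path are consecutive numbers; total l1+l2+l3-1 vertices (l_i >= 1). *)
Definition path_seq (s c : nat) : seq nat := 0 :: rcons (iota s c) 1.
Definition consec (s : seq nat) : seq (nat * nat) := zip s (behead s).
Definition theta_edges (l1 l2 l3 : nat) : seq (nat * nat) :=
  consec (path_seq 2 l1.-1) ++ consec (path_seq (l1 + 1) l2.-1)
  ++ consec (path_seq (l1 + l2) l3.-1).
Definition Theta (l1 l2 l3 : nat) : graph :=
  @Graph (l1 + l2 + l3 - 1) (fun x y =>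
    ((val x, val y) \in theta_edges l1 l2 l3) ||
    ((val y, val x) \in theta_edges l1 l2 l3)).

Definition P_list (H : graph) (L : 'I_(gn H) -> seq nat) : nat :=
  #|[set f : {dffun forall v : 'I_(gn H), seq_sub (L v)} |
     [forall x, forall y, gadj x y ==> (val (f x) != val (f y))]]|.

Definition P_chrom (H : graph) (m : nat) : nat :=
  #|[set f : {ffun 'I_(gn H) -> 'I_m} |
     [forall x, forall y, gadj x y ==> (f x != f y)]]|.

Definition chi (H : graph) : nat :=
  find (fun k => 0 < P_chrom H k) (iota 0 (gn H).+1).

Definition msized (H : graph) (m : nat) (L : 'I_(gn H) -> seq nat) : Prop :=
  forall v, uniq (L v) /\ size (L v) = m.

Arguments P_list : clear implicits.
Arguments msized : clear implicits.

Definition list_color_fn_is (H : graph) (m p : nat) : Prop :=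
  (exists2 L, msized H m L & P_list H L = p) /\
  (forall L, msized H m L -> p <= P_list H L).

Definition enum_chrom_choosable (H : graph) : Prop :=
  forall m, chi H <= m -> list_color_fn_is H m (P_chrom H m).

(* Main.v *)
Require Import Defs.
From mathcomp Require Import all_boot zify.
Set Implicit Arguments. Unset Strict Implicit. Unset Printing Implicit Defensive.

(* Summing over the colour c of the apex, it suffices to bound the number of
   colourings of Theta(2,2,2k) with c deleted from the lists, i.e. to show that
   lists of size n = m - 1 admit at least as many colourings as equal lists do.

   For n >= 3 this holds for every c. Let A, B be the lists of the two ends, N(a, b)
   the number of colourings of the long path with ends coloured a and b, and
   t = |B \ A|. A middle vertex with list M contributes n - 2 + [a = b] + [a notin M]
   + [a <> b][b notin M], and |(A u B) \ M| >= t, so the count is bounded below by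
   a combination of the sum of N, its diagonal sum and t times the least row or
   column sum of N. If t > 0 the last term suffices. If t = 0 the diagonal counts
   colourings of an even cycle, which the same estimate bounds by induction.

   For n = 2 a single c may leave only one colouring instead of two. The count N
   then vanishes at (k, k), where k is the common colour of the two ends; this
   determines the lists up to renaming, puts c in every list, and the remaining
   two colours of the apex make up for the loss. *)

(** * Colourings of paths and theta graphs *)

(* Ends of the path precoloured [a] and [b], inner vertices with lists [S]. *)
Fixpoint pcol (a : nat) (S : seq (seq nat)) (b : nat) : nat :=
  if S is s :: S' then \sum_(x <- s | x != a) pcol x S' b else a != b.

(* [A], [B] are the lists of the ends, [M1], [M2] those of the middle vertices of
   the paths of length 2, and [S] those of the inner vertices of the long path. *)
Definition tcol (A B M1 M2 : seq nat) (S : seq (seq nat)) : nat :=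
  \sum_(a <- A) \sum_(b <- B) pcol a [:: M1] b * pcol a [:: M2] b * pcol a S b.

Definition nlist (n : nat) (s : seq nat) : bool := uniq s && (size s == n).

Lemma leq_sum_in (T : eqType) (r : seq T) (P : pred T) (F G : T -> nat) :
  (forall x, x \in r -> P x -> F x <= G x) ->
  \sum_(x <- r | P x) F x <= \sum_(x <- r | P x) G x.
Proof.
move=> FG; rewrite big_seq_cond [leqRHS]big_seq_cond.
by apply: leq_sum => x /andP[]; exact: FG.
Qed.

Lemma sum_cond_nat (T : Type) (r : seq T) (P : pred T) (F : T -> nat) :
  \sum_(x <- r | P x) F x = \sum_(x <- r) P x * F x.
Proof. by rewrite big_mkcond; apply: eq_bigr => x _; case: (P x); lia. Qed.

Lemma sum_count (T : Type) (r : seq T) (P : pred T) :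
  \sum_(x <- r) (P x : nat) = count P r.
Proof. by rewrite -sum1_count [RHS]big_mkcond; apply: eq_bigr => x _; case: (P x). Qed.

Lemma sum_subseq (T : eqType) (r s : seq T) (P : pred T) (F : T -> nat) :
  subseq r s -> \sum_(x <- r | P x) F x <= \sum_(x <- s | P x) F x.
Proof.
elim: s r => [|y s IH] [|x r] //=; rewrite ?big_nil //.
case: eqP => [->|_] /IH; rewrite !big_cons; case: (P y) => //; lia.
Qed.

Lemma sum_pick (T : eqType) (r : seq T) (F : T -> nat) (y : T) :
  uniq r -> \sum_(x <- r) (x == y) * F x = (y \in r) * F y.
Proof.
move=> ur; rewrite -sum_cond_nat -big_filter.
case: (boolP (y \in r)) => yr.
  by rewrite filter_pred1_uniq // big_seq1 mul1n.
rewrite big_filter big1_seq // => x /andP[/eqP-> xr]; by rewrite xr in yr.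
Qed.

Lemma count_predC1 (s : seq nat) (y : nat) :
  uniq s -> count (fun x => x != y) s + (y \in s) = size s.
Proof.
by move=> us; rewrite -(count_predC (pred1 y) s) count_uniq_mem // addnC.
Qed.

Lemma pcol1_count (M : seq nat) (a b : nat) :
  pcol a [:: M] b = count (fun x => (x != a) && (x != b)) M.
Proof.
rewrite /= sum_cond_nat -sum_count; apply: eq_bigr => x _.
by case: (x != a); case: (x != b).
Qed.

Lemma pcol1C (M : seq nat) (a b : nat) : pcol a [:: M] b = pcol b [:: M] a.
Proof. by rewrite !pcol1_count; apply: eq_count => x; rewrite andbC. Qed.

(** Inclusion-exclusion for [p + 2] minus the number of distinct end colours in [M], arranged as a
    sum of nonnegative terms to avoid truncated subtraction. *)
Lemma pcol1E (p : nat) (M : seq nat) (a b : nat) : nlist p.+2 M ->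
  pcol a [:: M] b = p + (a == b) + (a \notin M) + (a != b) * (b \notin M).
Proof.
case/andP=> uM /eqP sM; rewrite pcol1_count.
have := count_predC1 a uM; have := count_predC1 b uM.
have -> : count (fun x => x != a) M = count (fun x => (x != a) && (x != b)) M +
    (a != b) * (b \in M).
  rewrite -(count_uniq_mem b uM).
  elim: M {uM sM} => [|y M IH] /=; first by rewrite muln0.
  rewrite IH; case: (y =P b) => [->|yb]; rewrite ?andbF ?andbT /=.
    by rewrite (eq_sym b a); case: (a == b) => /=; lia.
  by case: (y == a) => /=; lia.
rewrite sM; case: (a =P b) => [->|ab]; case: (b \in M) => /=; case: (a \in M) => /=; lia.
Qed.

(** Conditioning on the colour of the second inner vertex removes two vertices at once, which keeps
    the number of inner vertices odd in the inductions below. *)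
Lemma pcol2 (a : nat) (s t : seq nat) (S : seq (seq nat)) (b : nat) :
  pcol a [:: s, t & S] b = \sum_(y <- t) pcol a [:: s] y * pcol y S b.
Proof.
rewrite /=.
transitivity (\sum_(x <- s | x != a) \sum_(y <- t) (x != y) * pcol y S b).
  by apply: eq_bigr => x _; rewrite sum_cond_nat; apply: eq_bigr => y _; rewrite eq_sym.
rewrite exchange_big /=; apply: eq_bigr => y _; by rewrite big_distrl.
Qed.

(** Greedy colouring from [a]: each of the [size S + 1] vertices after it has at least [n]
    admissible colours. *)
Lemma row_sum_ge (n : nat) (B : seq nat) (S : seq (seq nat)) (a : nat) :
  nlist n.+1 B -> all (nlist n.+1) S ->
  n ^ (size S).+1 <= \sum_(b <- B) pcol a S b.
Proof.
move=> hB; elim: S a => [|s S IH] a /=.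
  move=> _; rewrite expn1 sum_count; case/andP: hB => uB /eqP sB.
  rewrite (eq_count (a2 := fun x => x != a)); last by move=> x; rewrite /= eq_sym.
  have := count_predC1 a uB; case: (a \in B); rewrite sB /=; lia.
case/andP=> hs hS; rewrite exchange_big /=.
apply: (@leq_trans (\sum_(x <- s | x != a) n ^ (size S).+1)); last first.
  by apply: leq_sum => x _; exact: IH.
rewrite big_const_seq iter_addn_0.
rewrite expnSr leq_mul2l; apply/orP; right.
by case/andP: hs => us /eqP ss; have := count_predC1 a us; case: (a \in s); rewrite ss /=; lia.
Qed.

Lemma col_sum_ge (n : nat) (A : seq nat) (S : seq (seq nat)) (b : nat) :
  nlist n.+1 A -> all (nlist n.+1) S ->
  n ^ (size S).+1 <= \sum_(a <- A) pcol a S b.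
Proof.
elim: S A => [|s S IH] A hA /=.
  move=> _; rewrite expn1 sum_count; case/andP: hA => uA /eqP sA.
  by have := count_predC1 b uA; case: (b \in A); rewrite sA /=; lia.
case/andP=> hs hS.
rewrite (eq_bigr (fun a => \sum_(x <- s) (x != a) * pcol x S b)); last first.
  by move=> a _; rewrite sum_cond_nat.
rewrite exchange_big /= expnS.
apply: (@leq_trans (n * \sum_(x <- s) pcol x S b)); first by rewrite leq_mul2l IH // orbT.
rewrite big_distrr /=; apply: leq_sum => x _; rewrite -big_distrl /= leq_mul2r; apply/orP; right.
rewrite sum_count (eq_count (a2 := fun y => y != x)); last by move=> y; rewrite /= eq_sym.
by case/andP: hA => uA /eqP sA; have := count_predC1 x uA; case: (x \in A); rewrite sA /=; lia.
Qed.

(* The value of [pcol] on [2 j + 1] equal lists of size [p + 2] containing the two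
   distinct end colours. *)
Fixpoint sval (p j : nat) : nat :=
  if j is j'.+1 then p.+1 ^ 2 * sval p j' + p else p.

(** The closed form [((p + 1)^(2 j + 2) - 1) / (p + 2)], free of division and subtraction. *)
Lemma svalE (p j : nat) : p.+2 * sval p j + 1 = p.+1 ^ j.*2.+2.
Proof.
elim: j => [|j IH] /=; first by rewrite !expnS expn0; lia.
by rewrite doubleS (expnD _ 2 j.*2.+2 : p.+1 ^ j.*2.+4 = _) -IH -mulnn; lia.
Qed.

Lemma nlist_sub_eq (n : nat) (s t : seq nat) :
  nlist n s -> nlist n t -> {subset s <= t} -> s =i t.
Proof.
move=> /andP[us /eqP ss] /andP[ut /eqP st] sub.
by have [] := uniq_min_size us sub; rewrite ?ss ?st.
Qed.

(** Two vertices are removed. Every colour of the second list is reached in at least [p] ways and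
    some colour [y] in [p + 1]; the column sum bound, rewritten by [svalE], and the induction
    hypothesis at [y] add up to the recursion of [sval]. *)
Lemma pcol_ge (p j : nat) (S : seq (seq nat)) (a b : nat) :
  all (nlist p.+2) S -> size S = j.*2.+1 -> sval p j <= pcol a S b.
Proof.
elim: j S a b => [|j IH] S a b.
  by case: S => [|s [|]] //; rewrite all_seq1 => hs _; rewrite (pcol1E _ _ hs) /=; lia.
case: S => [|s [|t S]] //=.
case/and3P=> hs ht hS; rewrite doubleS => -[sS].
change (p.+1 ^ 2 * sval p j + p <= pcol a [:: s, t & S] b).
(* [y] is [a] if [a] is in [t], any colour of [t] if [a] is in neither list, and otherwise a colour
   of [t] outside [s], which exists since the sizes agree and [a] lies in [s] only. *)
have [y yt hy] : exists2 y, y \in t & p < pcol a [:: s] y.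
  case: (boolP (a \in t)) => at_.
    by exists a => //; rewrite (pcol1E _ _ hs) eqxx; lia.
  case: (boolP (a \in s)) => as_; last first.
    case: t ht {at_} => [|y t] ht; first by case/andP: ht.
    by exists y; rewrite ?mem_head // (pcol1E _ _ hs) as_; lia.
  case: (boolP (all (mem s) t)) => [/allP sub|].
    by have := nlist_sub_eq ht hs sub => /(_ a); rewrite as_ (negbTE at_).
  case/allPn=> y yt ys; exists y => //; rewrite (pcol1E _ _ hs) ys.
  by have /negPf-> : a != y by [apply: contraNneq at_ => ->]; lia.
rewrite pcol2.
apply: (@leq_trans (\sum_(z <- t) (p * pcol z S b + (z == y) * pcol z S b))); last first.
  apply: leq_sum => z _; rewrite -mulnDl leq_mul2r; apply/orP; right.
  case: eqP => [->|_]; last by rewrite (pcol1E _ _ hs); lia.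
  by rewrite addn1.
rewrite big_split /= -big_distrr /= sum_pick ?yt; last by case/andP: ht.
have := col_sum_ge b ht hS; rewrite sS -svalE.
have := IH S y b hS sS; rewrite mul1n.
move: (\sum_(z <- t) _) => T; nia.
Qed.

(** * Lists of size at least three *)

Section Estimate.

Variables (p rho : nat) (A B : seq nat) (N : nat -> nat -> nat).
Hypotheses (hA : nlist p.+2 A) (hB : nlist p.+2 B).
Hypothesis rowN : forall a, rho <= \sum_(b <- B) N a b.
Hypothesis colN : forall b, rho <= \sum_(a <- A) N a b.

Let t := count [predC A] B.
Let tot := \sum_(a <- A) \sum_(b <- B) N a b.
Let diag := \sum_(a <- A) (a \in B) * N a a.
(** The last two terms of [pcol1E], with [a != b] replaced by [b \notin A], which implies it for [a]
    in [A]. The second term then no longer involves [a], so its sum splits into whole columns. *)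
Let bonus (M : seq nat) (a b : nat) : nat := (a \notin M) + (b \notin A) * (b \notin M).

(** The union of [A] and [B] has [p + 2 + t] colours, of which [M] covers at most [p + 2]. *)
Lemma missing_ge (M : seq nat) : nlist p.+2 M ->
  t <= count [predC M] A + count (fun b => (b \notin A) && (b \notin M)) B.
Proof.
case/andP: hA hB => uA /eqP sA /andP[uB _] /andP[uM /eqP sM].
pose U := A ++ [seq b <- B | b \notin A].
have uU : uniq U.
  rewrite cat_uniq uA filter_uniq // andbT; apply/hasPn => b.
  by rewrite mem_filter => /andP[].
have sU : size U = p.+2 + t by rewrite size_cat sA size_filter.
have : count (mem M) U <= size M.
  rewrite -size_filter; apply: uniq_leq_size; first exact: filter_uniq.
  by move=> x; rewrite mem_filter => /andP[].
have := count_predC (mem M) U; rewrite sU sM.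
have -> : count (predC (mem M)) U =
    count [predC M] A + count (fun b => (b \notin A) && (b \notin M)) B.
  rewrite count_cat count_filter; congr (_ + _).
  by apply: eq_count => x /=; rewrite andbC.
lia.
Qed.

(** Each colour of [A] missing from [M] contributes a full row, and each colour of [B] outside both
    [A] and [M] a full column; all of these are at least [rho]. *)
Lemma bonus_sum_ge (M : seq nat) : nlist p.+2 M ->
  t * rho <= \sum_(a <- A) \sum_(b <- B) bonus M a b * N a b.
Proof.
move=> hM; rewrite /bonus.
under eq_bigr => a _ do
  (under eq_bigr => b _ do rewrite mulnDl; rewrite big_split /= -big_distrr /=).
rewrite big_split /= [X in _ + X]exchange_big /=.
apply: (@leq_trans ((count [predC M] A +
    count (fun b => (b \notin A) && (b \notin M)) B) * rho)).
  by rewrite leq_mul2r missing_ge // orbT.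
rewrite mulnDl -!sum_count !big_distrl /=; apply: leq_add.
  by apply: leq_sum => a _; rewrite leq_mul2l rowN orbT.
apply: leq_sum => b _; rewrite -big_distrr /= -mulnb leq_mul2l colN; exact: orbT.
Qed.

Lemma diagE : \sum_(a <- A) \sum_(b <- B) (a == b) * N a b = diag.
Proof.
apply: eq_bigr => a _; rewrite -sum_pick; last by case/andP: hB.
by apply: eq_bigr => b _; rewrite eq_sym.
Qed.

Lemma pcol1_ge (M : seq nat) (a b : nat) : nlist p.+2 M -> a \in A ->
  p + (a == b) + bonus M a b <= pcol a [:: M] b.
Proof.
move=> hM aA; rewrite (pcol1E _ _ hM) /bonus.
by case: eqP => [<-|_]; rewrite ?aA //=; case: (b \in A) => /=; lia.
Qed.

Lemma vertex_sum_ge (M : seq nat) : nlist p.+2 M ->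
  p * tot + diag + t * rho <=
  \sum_(a <- A) \sum_(b <- B) pcol a [:: M] b * N a b.
Proof.
move=> hM; apply: (@leq_trans (p * tot + diag +
    \sum_(a <- A) \sum_(b <- B) bonus M a b * N a b)).
  by rewrite leq_add2l bonus_sum_ge.
rewrite -diagE /tot big_distrr /= -!big_split /=.
apply: leq_sum_in => a aA _; rewrite big_distrr /= -!big_split /=.
by apply: leq_sum => b _; rewrite -!mulnDl leq_mul2r pcol1_ge // orbT.
Qed.

(** In the product of the two bounds [pcol1_ge], the square of [p + (a == b)] gives [p^2], and
    [2 p + 1] more on the diagonal; of the bonus terms only those multiplied by [p] are kept. *)
Lemma two_vertex_sum_ge (M1 M2 : seq nat) : nlist p.+2 M1 -> nlist p.+2 M2 ->
  p ^ 2 * tot + (2 * p + 1) * diag + 2 * p * (t * rho) <=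
  \sum_(a <- A) \sum_(b <- B) pcol a [:: M1] b * pcol a [:: M2] b * N a b.
Proof.
move=> h1 h2.
have b1 := bonus_sum_ge h1; have b2 := bonus_sum_ge h2.
apply: (@leq_trans (p ^ 2 * tot + (2 * p + 1) * diag +
    (p * (\sum_(a <- A) \sum_(b <- B) bonus M1 a b * N a b) +
     p * (\sum_(a <- A) \sum_(b <- B) bonus M2 a b * N a b)))); first by nia.
rewrite -diagE /tot !big_distrr /= -!big_split /=.
apply: leq_sum_in => a aA _; rewrite !big_distrr /= -!big_split /=.
apply: leq_sum => b _; rewrite !mulnA -!mulnDl leq_mul2r; apply/orP; right.
apply: leq_trans (leq_mul (pcol1_ge b h1 aA) (pcol1_ge b h2 aA)).
rewrite -mulnn; case: (a == b) => /=; nia.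
Qed.

Lemma common_count : count (mem B) A + t = p.+2.
Proof.
case/andP: hA hB => uA /eqP sA /andP[uB /eqP sB]; rewrite /t.
have -> : count (mem B) A = count (mem A) B.
  rewrite -!size_filter; apply/perm_size/uniq_perm; rewrite ?filter_uniq //.
  by move=> x; rewrite !mem_filter andbC.
by rewrite -sB -(count_predC (mem A) B).
Qed.

Lemma diag_ge (s : nat) : (forall a b, s <= N a b) -> count (mem B) A * s <= diag.
Proof.
move=> hs; rewrite -sum_count big_distrl /=.
by apply: leq_sum => a _; rewrite leq_mul2l hs orbT.
Qed.

(** When [t = 0] the ends have the same colours, and the diagonal sum closes the path into a
    cycle. *)
Lemma diag_full : t = 0 -> diag = \sum_(a <- A) N a a.
Proof.
move=> t0; rewrite /diag; apply: eq_big_seq => a aA.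
have := common_count; rewrite t0 addn0 => cA.
have /allP/(_ a aA) /= -> : all (mem B) A.
  by rewrite all_count cA; case/andP: hA => _ /eqP ->.
by rewrite mul1n.
Qed.

End Estimate.

Lemma sum_const_ge (T : Type) (r : seq T) (F : T -> nat) (m : nat) :
  (forall x, m <= F x) -> size r * m <= \sum_(x <- r) F x.
Proof.
by move=> mF; rewrite -sum1_size big_distrl /=; apply: leq_sum => x _; rewrite mul1n.
Qed.

(** The bound is the chromatic polynomial [(p + 1)^(2 j + 2) + (p + 1)] of the even cycle. With [A]
    and [t] as ends, [s] is a middle vertex between them and [S] the remaining path, so
    [vertex_sum_ge] applies. Equal ends reduce to a shorter cycle. *)
Lemma cycle_ge (p j : nat) (A : seq nat) (S : seq (seq nat)) : 0 < p ->
  nlist p.+2 A -> all (nlist p.+2) S -> size S = j.*2.+1 ->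
  p.+2 * (sval p j + 1) <= \sum_(a <- A) pcol a S a.
Proof.
move=> p0; elim: j S A => [|j IH] S A hA.
  case: S => [|s [|]] //; rewrite all_seq1 => hs _.
  case/andP: hA => _ /eqP <-; apply: sum_const_ge => a.
  by rewrite (pcol1E _ _ hs) eqxx /=; lia.
case: S => [|s [|t S]] //= /and3P[hs ht hS]; rewrite doubleS => -[sS].
change (p.+2 * (p.+1 ^ 2 * sval p j + p + 1) <= \sum_(a <- A) pcol a [:: s, t & S] a).
under eq_bigr => a _ do (rewrite pcol2; under eq_bigr => y _ do rewrite pcol1C).
rewrite exchange_big /=.
pose rho := p.+1 ^ j.*2.+2; pose N y a := pcol y S a.
have rowN y : rho <= \sum_(a <- A) N y a by have := row_sum_ge y hA hS; rewrite sS.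
have colN a : rho <= \sum_(y <- t) N y a by have := col_sum_ge a ht hS; rewrite sS.
apply: leq_trans (vertex_sum_ge ht hA rowN colN hs).
have tot : p.+2 * rho <= \sum_(y <- t) \sum_(a <- A) N y a.
  by case/andP: ht => _ /eqP <-; exact: sum_const_ge.
have sN y a : sval p j <= N y a by exact: pcol_ge.
have := common_count ht hA; have := diag_ge t A sN; have := diag_full N ht hA.
have := IH S t ht hS sS; rewrite -/(N _ _).
have := svalE p j; rewrite -/rho; move: tot.
have : p <= sval p j by case: (j) => //= j'; lia.
rewrite -mulnn.
move: (count _ A) (count _ t) (\sum_(_ <- t) _ * _) (\sum_(_ <- t) N _ _) (sval p j) => u c D D' s'.
clear rowN colN sN; clearbody rho; move: (\sum_(_ <- t) _) => T ps Tge rhoE IHD; case: u => [|u].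
  move=> /(_ erefl) -> _ _.
  have : p * (p.+2 * rho) <= p * T by rewrite leq_mul2l Tge orbT.
  by rewrite -rhoE; lia.
move=> _ Dge cu.
(* With [u + 1] colours of [A] outside [t], the surplus [(u + 1) * rho] makes up for the missing
   diagonal terms. *)
have us : p.+1 * 1 <= p.+1 * (u.+1 * s') by rewrite leq_mul2l muln_gt0; lia.
have cus : c * s' + u.+1 * s' = p.+2 * s' by rewrite -mulnDl cu.
have : p * (p.+2 * rho) <= p * T by rewrite leq_mul2l Tge orbT.
by rewrite -rhoE; lia.
Qed.

(* The value of [tcol] on equal lists of size [p + 2], for [s = sval p j]. *)
Definition tval (p s : nat) : nat := p.+2 * (p.+1 ^ 2 * (s + 1) + p.+1 * p ^ 2 * s).

(** Once the sum of [N] has paid for the part with factor [p^2], the diagonal and [t * rho] must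
    supply [(2 p + 1)(p + 2)(s + 1)]. For [t = 0] this is [cycle_ge]. For [t > 0] the crude
    [diag_ge] suffices if [s >= 5], which holds for [j > 0], while [j = 0] uses the sharper bound
    [p + 1] on diagonal entries. *)
Lemma theta_ge (p j : nat) (A B M1 M2 : seq nat) (S : seq (seq nat)) : 0 < p ->
  nlist p.+2 A -> nlist p.+2 B -> nlist p.+2 M1 -> nlist p.+2 M2 ->
  all (nlist p.+2) S -> size S = j.*2.+1 ->
  tval p (sval p j) <= tcol A B M1 M2 S.
Proof.
move=> p0 hA hB h1 h2 hS sS; rewrite /tcol.
pose rho := p.+1 ^ j.*2.+2; pose N a b := pcol a S b.
have rowN a : rho <= \sum_(b <- B) N a b by have := row_sum_ge a hB hS; rewrite sS.
have colN b : rho <= \sum_(a <- A) N a b by have := col_sum_ge b hA hS; rewrite sS.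
apply: leq_trans (two_vertex_sum_ge hA hB rowN colN h1 h2).
have tot : p.+2 * rho <= \sum_(a <- A) \sum_(b <- B) N a b.
  by case/andP: hA => _ /eqP <-; exact: sum_const_ge.
have sN a b : sval p j <= N a b by exact: pcol_ge.
have := common_count hA hB; have := diag_ge A B sN; have := diag_full N hA hB.
have d1 : j = 0 -> count (mem B) A * (p + 1) <= \sum_(a <- A) (a \in B) * N a a.
  move=> j0; rewrite -sum_count big_distrl /=; apply: leq_sum => a _.
  rewrite leq_mul2l; apply/orP; right; rewrite /N.
  case: S hS sS {N rowN colN tot sN} => [|s [|]]; rewrite j0 // all_seq1 => hs _.
  by rewrite (pcol1E _ _ hs) eqxx /=; lia.
have := cycle_ge p0 hA hS sS; rewrite -/(N _ _).
have := svalE p j; rewrite -/rho; move: tot d1.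
have : j = 0 -> sval p j = p by move=> ->.
have : 0 < j -> 5 * p <= sval p j.
  case: (j) => //= j' _.
  have : p <= sval p j' by case: (j') => //= j''; lia.
  by rewrite -mulnn; nia.
rewrite /tval -!mulnn.
move: (count _ A) (count _ B) (\sum_(_ <- A) _ * _) (\sum_(_ <- A) N _ _) (sval p j) => c t D D' s.
clear rowN colN sN; clearbody rho; move: (\sum_(_ <- A) _) => T s5 s0 Tge d1 rhoE IHD diagE Dge cu.
have Tge' : (p * p) * (p.+2 * rho) <= (p * p) * T by rewrite leq_mul2l Tge orbT.
suff : (2 * p + 1) * (p.+2 * (s + 1)) <= (2 * p + 1) * D + 2 * p * (t * rho).
  by move: Tge'; rewrite -{1}rhoE; move: (2 * p * (t * rho)) => X; lia.
have mulD x y : x <= y -> (2 * p + 1) * x <= (2 * p + 1) * y.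
  by move=> xy; rewrite leq_mul2l xy orbT.
case: (posnP t) => t0.
  by rewrite (diagE t0) t0 mul0n muln0 addn0; exact: mulD.
have {}cu : p.+2 = c + t by lia.
case: (posnP j) => j0.
  move: (mulD _ _ (d1 j0)); move: (s0 j0) => ?; subst s.
  (* Since [c + t = p + 2], what remains is that the [t] missing diagonal terms are covered by
     [t * rho]. *)
  have : (t * p.+1) * (2 * p + 1) <= (t * p.+1) * (2 * p * p.+1).
    by rewrite leq_mul2l; apply/orP; right; nia.
  have -> : rho = p.+1 * p.+1 by lia.
  by rewrite cu; lia.
have v5 : 5 <= t * s by have := s5 j0; nia.
move: (mulD _ _ Dge).
have cus : (2 * p + 1) * (c * s + t * s) = (2 * p + 1) * (p.+2 * s).
  by rewrite -mulnDl -cu.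
rewrite -rhoE; case: p p0 cu cus {s5 s0 d1 IHD Tge' rhoE mulD Tge hA hB h1 h2 hS} => // q _ cu cus.
(* The net coefficient of [t * s] is [2 p (p + 2) - (2 p + 1)], written with [p = q + 1] to avoid
   subtraction. *)
have : (2 * q * q + 6 * q + 3) * 5 <= (2 * q * q + 6 * q + 3) * (t * s).
  by rewrite leq_mul2l v5 orbT.
lia.
Qed.

(** * Lists of size two *)

Lemma leq_pcol (S T : seq (seq nat)) (a b : nat) :
  all2 subseq S T -> pcol a S b <= pcol a T b.
Proof.
elim: S T a => [|s S IH] [|t T] a //= /andP[st ST].
apply: leq_trans (sum_subseq _ _ st).
by apply: leq_sum => x _; exact: IH.
Qed.

Lemma leq_tcol (A A' B B' M M' K K' : seq nat) (S S' : seq (seq nat)) :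
  subseq A A' -> subseq B B' -> subseq M M' -> subseq K K' -> all2 subseq S S' ->
  tcol A B M K S <= tcol A' B' M' K' S'.
Proof.
move=> hA hB hM hK hS; rewrite /tcol; apply: leq_trans (sum_subseq _ _ hA).
apply: leq_sum => a _; apply: leq_trans (sum_subseq _ _ hB).
by apply: leq_sum => b _; rewrite !leq_mul // leq_pcol //= ?hM ?hK ?hS.
Qed.

Lemma tcol_perm (A A' B B' M M' K K' : seq nat) (S : seq (seq nat)) :
  perm_eq A A' -> perm_eq B B' -> perm_eq M M' -> perm_eq K K' ->
  tcol A B M K S = tcol A' B' M' K' S.
Proof.
move=> hA hB hM hK; rewrite /tcol (perm_big _ hA); apply: eq_bigr => a _.
rewrite (perm_big _ hB); apply: eq_bigr => b _ /=.
by rewrite (perm_big _ hM) (perm_big _ hK).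
Qed.

Lemma tcolC (A B M K : seq nat) (S : seq (seq nat)) :
  tcol A B M K S = tcol A B K M S.
Proof.
by apply: eq_bigr => a _; apply: eq_bigr => b _; rewrite [X in X * _]mulnC.
Qed.

(** Deleting the apex colour from a 3-list leaves two or three colours, so the size is only bounded
    below. *)
Definition ulist (s : seq nat) : bool := uniq s && (1 < size s).

Lemma pcol_cons_eq0 (a b : nat) (s : seq nat) (S : seq (seq nat)) :
  pcol a (s :: S) b = 0 <-> {in s, forall x, x != a -> pcol x S b = 0}.
Proof.
split=> [/eqP|h] /=.
  rewrite /= sum_nat_seq_eq0 => /allP h x xs xa.
  by move: (h x xs); rewrite /= xa => /eqP.
by rewrite big1_seq // => x /andP[xa xs]; exact: h.
Qed.

Lemma ulist_other (s : seq nat) (a : nat) : ulist s -> exists2 x, x \in s & x != a.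
Proof.
case: s => [|x [|y s]] // /andP[/= /andP[]]; rewrite inE negb_or => /andP[xy _] _ _.
case: (x =P a) => [xa|/eqP xa]; last by exists x; rewrite ?mem_head.
by exists y; rewrite ?inE ?eqxx ?orbT // -xa eq_sym.
Qed.

Lemma ulist_perm2 (s : seq nat) (a c : nat) :
  ulist s -> a != c -> {in s, forall x, x != a -> x = c} -> perm_eq s [:: a; c].
Proof.
move=> /andP[us ss] ac h.
have sub : {subset s <= [:: a; c]}.
  by move=> x xs; rewrite !inE; case: eqP => //= /eqP xa; rewrite (h x).
have [_ e] := uniq_min_size us sub ss.
by apply: uniq_perm; rewrite //= inE ac.
Qed.

(** Some colour [x != a] of the first list has vanishing counts to both [b] and [b'], so the claim
    passes to the tail. *)
Lemma pcol_row0 (S : seq (seq nat)) (a b b' : nat) : all ulist S ->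
  pcol a S b = 0 -> pcol a S b' = 0 -> b = b'.
Proof.
elim: S a => [|s S IH] a.
  by move=> _ /=; do 2 (case: eqP => // <- _).
move=> /= /andP[us uS] /pcol_cons_eq0 h /pcol_cons_eq0 h'.
have [x xs xa] := ulist_other a us.
exact: IH uS (h x xs xa) (h' x xs xa).
Qed.

(** Every colour of [s] other than [a] has a vanishing tail, so column uniqueness leaves only one.
    That uniqueness is a hypothesis because [pcol_col0] is proved by induction through this
    lemma. *)
Lemma pcol_step0 (S : seq (seq nat)) (s : seq nat) (a b : nat) : ulist s ->
  (forall a a', pcol a S b = 0 -> pcol a' S b = 0 -> a = a') ->
  pcol a (s :: S) b = 0 ->
  exists c, [/\ a != c, pcol c S b = 0 & perm_eq s [:: a; c]].
Proof.
move=> us col /pcol_cons_eq0 h; have [c cs ca] := ulist_other a us.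
exists c; split; rewrite 1?eq_sym //; first exact: h.
apply: ulist_perm2; rewrite 1?eq_sym // => x xs xa.
by apply: col; apply: h.
Qed.

(** The first list is both [[:: a; c]] and [[:: a'; c]], since by induction the next colour [c] is
    the same. *)
Lemma pcol_col0 (S : seq (seq nat)) (a a' b : nat) : all ulist S ->
  pcol a S b = 0 -> pcol a' S b = 0 -> a = a'.
Proof.
elim: S a a' => [|s S IH] a a'.
  by move=> _ /=; do 2 (case: eqP => // -> _).
move=> /= /andP[us uS] h h'.
have col x y := IH x y uS.
have [c [ac c0 sac]] := pcol_step0 us col h.
have [c' [ac' c0' sac']] := pcol_step0 us col h'.
have cc := col _ _ c0 c0'; subst c'.
have := perm_mem sac' a; rewrite (perm_mem sac) !inE eqxx (negPf ac) !orbF.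
by move=> /esym/eqP.
Qed.

Lemma pcol0_cons (S : seq (seq nat)) (s : seq nat) (a b : nat) :
  ulist s -> all ulist S -> pcol a (s :: S) b = 0 ->
  exists c, [/\ a != c, pcol c S b = 0 & perm_eq s [:: a; c]].
Proof. by move=> us uS; apply: pcol_step0 => // x y; exact: pcol_col0. Qed.

Lemma pcol0_size (S : seq (seq nat)) (a b : nat) : all ulist S ->
  pcol a S b = 0 -> all (fun s => size s == 2) S.
Proof.
elim: S a => [|s S IH] a //= /andP[us uS] h.
have [c [_ c0 /perm_size ->]] := pcol0_cons us uS h.
by rewrite (IH c).
Qed.

(* A vanishing count forces the lists to be [{c_0, c_1}, {c_1, c_2}, ...] with
   [c_0 = a] and [c_r = b]; prepending [a'] and appending [b'], the colourings
   from [a'] to [b'] correspond to the indices [i] with [c_(i-1) <> c_(i+1)],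
   and these must lead from [a] to [b'] and from [a'] to [b] when [r] is odd. *)
Lemma pcol_opposite (S : seq (seq nat)) (a a' b b' : nat) : all ulist S ->
  pcol a S b = 0 -> a' != a -> b' != b ->
  (if odd (size S) then (a != b') + (a' != b) else (a != b) + (a' != b'))
    <= pcol a' S b'.
Proof.
elim: S a a' => [|s S IH] a a' /=.
  by move=> _; case: eqP => // _ _ _ _; rewrite add0n.
move=> /andP[us uS] h a'a b'b.
have [c [ac c0 sac]] := pcol0_cons us uS h.
rewrite (perm_big _ sac) !big_cons big_nil (eq_sym a a') a'a.
have := IH c a uS c0 ac b'b.
have cpos : 0 < pcol c S b'.
  by rewrite lt0n; apply/negP => /eqP c0'; rewrite (pcol_row0 uS c0 c0') eqxx in b'b.
case: (odd (size S)) => /=; case: (c =P a') => /= ?; subst => //; lia.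
Qed.

Lemma pcol1_diag (M : seq nat) (a b : nat) : ulist M -> pcol a [:: M] b = 0 -> a != b.
Proof.
move=> uM; apply: contra_eq_neq => ->; have [x xM xb] := ulist_other b uM.
by apply/eqP => /pcol_cons_eq0 /(_ x xM xb) /=; rewrite xb.
Qed.

(** Abstracts the matrix of counts of any of the three paths, all of which have an odd number of
    inner vertices: at most one zero in each row and column, and the bound of [pcol_opposite]. *)
Definition zmat (V : nat -> nat -> nat) : Prop :=
  [/\ forall x y y', V x y = 0 -> V x y' = 0 -> y = y',
      forall x x' y, V x y = 0 -> V x' y = 0 -> x = x' &
      forall x x' y y', V x y = 0 -> x' != x -> y' != y ->
        (x != y') + (x' != y) <= V x' y'].

Lemma pcol_zmat (S : seq (seq nat)) : all ulist S -> odd (size S) ->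
  zmat (fun a b => pcol a S b).
Proof.
move=> uS oS; split=> [x y y'|x x' y|x x' y y' h xx yy].
- exact: pcol_row0.
- exact: pcol_col0.
- by have := pcol_opposite uS h xx yy; rewrite oS.
Qed.

(** By uniqueness of zeros in columns and rows, [U] and [V] do not vanish at [(a', b')]; the zero of
    [W] at the opposite corner bounds its entry there by two indicators. *)
Lemma zmat_distinct (U V W : nat -> nat -> nat) (a a' b b' : nat) :
  zmat U -> zmat V -> zmat W -> a' != a -> b' != b ->
  W a b = 0 -> U a b' = 0 -> V a' b = 0 -> (a = b' -> a' = b -> False) ->
  0 < W a' b' * U a' b' * V a' b' /\
  (W a' b' * U a' b' * V a' b' <= 1 -> a = b' \/ a' = b).
Proof.
move=> [_ colU _] [rowV _ _] [_ _ oppW] aa bb W0 U0 V0 nab.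
have := oppW _ _ _ _ W0 aa bb.
have : U a' b' <> 0 by move=> h; rewrite (colU _ _ _ U0 h) eqxx in aa.
have : V a' b' <> 0 by move=> h; rewrite (rowV _ _ _ V0 h) eqxx in bb.
by do 2 case: eqP => //=; nia.
Qed.

(* The only 2-list assignments admitting a single colouring. *)
Definition bad (A B M1 M2 : seq nat) (S : seq (seq nat)) : Prop :=
  exists k x y, [/\ uniq [:: k; x; y], perm_eq A [:: k; x], perm_eq B [:: k; y],
    pcol k S k = 0 &
    (perm_eq M1 [:: x; y] /\ (perm_eq M2 [:: k; y] \/ perm_eq M2 [:: k; x])) \/
    (perm_eq M2 [:: x; y] /\ (perm_eq M1 [:: k; y] \/ perm_eq M1 [:: k; x]))].

Lemma bad_perm (A A' B B' M1 M2 : seq nat) (S : seq (seq nat)) :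
  perm_eq A' A -> perm_eq B' B -> bad A B M1 M2 S -> bad A' B' M1 M2 S.
Proof.
move=> hA hB [k [x [y [h1 h2 h3 h4 h5]]]]; exists k, x, y; split=> //.
  exact: perm_trans h2.
exact: perm_trans h3.
Qed.

Lemma pcol1_eq0 (M : seq nat) (a b : nat) :
  ulist M -> pcol a [:: M] b = 0 -> perm_eq M [:: a; b].
Proof.
move=> uM h; have [c [_ /= c0 sac]] := pcol0_cons (S := [::]) uM isT h.
by move: c0 sac; case: eqP => // ->.
Qed.

(** [bad] read off the matrices: a zero of a short path at [(x, y)] amounts to the middle list being
    [[:: x; y]]. *)
Definition zbad (X Y Z : nat -> nat -> nat) (a a' b b' : nat) : Prop :=
  exists k x y, [/\ uniq [:: k; x; y], perm_eq [:: a; a'] [:: k; x],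
    perm_eq [:: b; b'] [:: k; y], Z k k = 0 &
    (X x y = 0 /\ (Y k y = 0 \/ Y x k = 0)) \/ (Y x y = 0 /\ (X k y = 0 \/ X x k = 0))].

Lemma zbadC (X Y Z : nat -> nat -> nat) (a a' b b' : nat) :
  zbad Y X Z a a' b b' -> zbad X Y Z a a' b b'.
Proof.
by case=> k [x [y [h1 h2 h3 h4 h5]]]; exists k, x, y; split=> //; case: h5; [right|left].
Qed.

Section ThreeZeros.

Variables (X Y Z : nat -> nat -> nat) (a a' b b' : nat).
Hypotheses (zX : zmat X) (zY : zmat Y) (zZ : zmat Z).
Hypotheses (dX : forall x y, X x y = 0 -> x != y) (dY : forall x y, Y x y = 0 -> x != y).
Hypotheses (aa : a' != a) (bb : b' != b).

Lemma zmat_row (V : nat -> nat -> nat) (x : nat) :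
  zmat V -> V x b = 0 -> V x b' = 0 -> False.
Proof. by case=> row _ _ h h'; move: bb; rewrite (row _ _ _ h h') eqxx. Qed.

Lemma zmat_col (V : nat -> nat -> nat) (y : nat) :
  zmat V -> V a y = 0 -> V a' y = 0 -> False.
Proof. by case=> _ col _ h h'; move: aa; rewrite (col _ _ _ h h') eqxx. Qed.

(** The opposite bound from the zero at [(a, b')] is [(a != b) + (a' != b')], and it bounds an entry
    that is zero. *)
Lemma zmat_anti (V : nat -> nat -> nat) :
  zmat V -> V a b' = 0 -> V a' b = 0 -> a = b /\ a' = b'.
Proof.
case=> _ _ opp h h'; have := opp _ a' _ b h aa; rewrite h' eq_sym bb => /(_ isT).
by do 2 case: eqP.
Qed.

(** A second zero of [X] would share a row or column with the first, and one matrix vanishing at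
    both other corners forces [a = b], against [dX]. So [Y] and [Z] each block one corner, and [k]
    is the colour at which the zero of [Z] is diagonal. *)
Lemma three_zeros_X : X a b = 0 -> X a b' * Y a b' * Z a b' = 0 ->
  X a' b * Y a' b * Z a' b = 0 ->
  0 < X a' b' * Y a' b' * Z a' b' /\
  (X a' b' * Y a' b' * Z a' b' <= 1 -> zbad X Y Z a a' b b').
Proof.
move=> Xab /eqP; rewrite !muln_eq0 => /orP[/orP[]|] /eqP ab'.
- by case: (zmat_row zX Xab ab').
- move=> /eqP; rewrite !muln_eq0 => /orP[/orP[]|] /eqP a'b.
  + by case: (zmat_col zX Xab a'b).
  + by have [e _] := zmat_anti zY ab' a'b; have := dX Xab; rewrite e eqxx.
  + have n1 : a <> b' by apply/eqP/dY.
    have [|pos le1] := zmat_distinct zY zZ zX aa bb Xab ab' a'b; first by [].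
    split=> // /le1[//|e]; exists b, a, b'; subst a'; split=> //.
    * by rewrite /= !inE; move: aa bb; lia.
    * by apply/permP => P /=; lia.
    * by right; split=> //; right.
- move=> /eqP; rewrite !muln_eq0 => /orP[/orP[]|] /eqP a'b.
  + by case: (zmat_col zX Xab a'b).
  + have n1 : a' <> b by apply/eqP/dY.
    have [|] := zmat_distinct zZ zY zX aa bb Xab ab' a'b; first by [].
    rewrite mulnAC => pos le1; split=> // /le1[e|//]; exists a, a', b; subst b'; split=> //.
    * by rewrite /= !inE; move: aa bb; lia.
    * by apply/permP => P /=; lia.
    * by right; split=> //; left.
  + by have [e _] := zmat_anti zZ ab' a'b; have := dX Xab; rewrite e eqxx.
Qed.

(** Whether one short path blocks both remaining corners or each blocks one, [a != b'] and [a' != b]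
    follow, so the entry of [Z] at the last corner is at least two. *)
Lemma three_zeros_Z : Z a b = 0 -> X a b' * Y a b' = 0 -> X a' b * Y a' b = 0 ->
  1 < X a' b' * Y a' b' * Z a' b'.
Proof.
move=> Zab ab0 a'b0; have [_ _ /(_ _ _ _ _ Zab aa bb) oZ] := zZ.
have same V V' : zmat V -> V a b' = 0 -> V a' b = 0 ->
    (forall x y, V x y = 0 -> x != y) -> (forall x y, V' x y = 0 -> x != y) ->
    1 < V a' b' * V' a' b' * Z a' b'.
  move=> zV Vab' Va'b dV dV'; have [e e'] := zmat_anti zV Vab' Va'b.
  have : V a' b' <> 0 by move=> /dV; rewrite e' eqxx.
  have : V' a' b' <> 0 by move=> /dV'; rewrite e' eqxx.
  move: oZ; rewrite -e -e' aa eq_sym aa; nia.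
have diff V V' : zmat V -> zmat V' -> V a b' = 0 -> V' a' b = 0 ->
    (forall x y, V x y = 0 -> x != y) -> (forall x y, V' x y = 0 -> x != y) ->
    1 < V a' b' * V' a' b' * Z a' b'.
  move=> zV zV' Vab' Va'b dV dV'.
  have : V a' b' <> 0 by move=> h; case: (zmat_col zV Vab' h).
  have : V' a' b' <> 0 by move=> h; case: (zmat_row zV' Va'b h).
  move: oZ; rewrite (dV _ _ Vab') (dV' _ _ Va'b); nia.
move/eqP: ab0; rewrite muln_eq0 => /orP[] /eqP ab0;
  move/eqP: a'b0; rewrite muln_eq0 => /orP[] /eqP a'b0.
- exact: same.
- exact: diff.
- by rewrite [X in X * _]mulnC; apply: diff.
- by rewrite [X in X * _]mulnC; apply: same.
Qed.

End ThreeZeros.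

Lemma three_zeros (X Y Z : nat -> nat -> nat) (a a' b b' : nat) :
  zmat X -> zmat Y -> zmat Z ->
  (forall x y, X x y = 0 -> x != y) -> (forall x y, Y x y = 0 -> x != y) ->
  a' != a -> b' != b -> X a b * Y a b * Z a b = 0 ->
  X a b' * Y a b' * Z a b' = 0 -> X a' b * Y a' b * Z a' b = 0 ->
  0 < X a' b' * Y a' b' * Z a' b' /\
  (X a' b' * Y a' b' * Z a' b' <= 1 -> zbad X Y Z a a' b b').
Proof.
move=> zX zY zZ dX dY aa bb /eqP; rewrite !muln_eq0 => /orP[/orP[]|] /eqP h h1 h2.
- exact: three_zeros_X.
- rewrite (mulnC (X a b')) in h1; rewrite (mulnC (X a' b)) in h2; rewrite (mulnC (X a' b')).
  by have [? ?] := three_zeros_X zY zX zZ dY dX aa bb h h1 h2; split=> // le1; apply: zbadC; auto.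
have h1' : X a b' * Y a b' = 0.
  by move/eqP: h1; rewrite muln_eq0 => /orP[/eqP //|/eqP h1]; case: (zmat_row bb zZ h h1).
have h2' : X a' b * Y a' b = 0.
  by move/eqP: h2; rewrite muln_eq0 => /orP[/eqP //|/eqP h2]; case: (zmat_col aa zZ h h2).
by have := three_zeros_Z zX zY zZ dX dY aa bb h h1' h2'; split; lia.
Qed.

Lemma bad_of_zbad (M1 M2 : seq nat) (S : seq (seq nat)) (a a' b b' : nat) :
  ulist M1 -> ulist M2 ->
  zbad (fun x y => pcol x [:: M1] y) (fun x y => pcol x [:: M2] y)
    (fun x y => pcol x S y) a a' b b' ->
  bad [:: a; a'] [:: b; b'] M1 M2 S.
Proof.
move=> u1 u2 [k [x [y [ukxy pA pB S0 hM]]]]; exists k, x, y; split=> //.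
by case: hM => -[h [h'|h']]; [left|left|right|right]; (split; first exact: pcol1_eq0);
  [left|right|left|right]; rewrite 1?perm_sym; try exact: pcol1_eq0;
  rewrite perm_sym; apply: perm_trans (pcol1_eq0 _ h') _ => //; apply/permP => P /=; lia.
Qed.

(** A total of at most one leaves three of the four end pairs with count zero; swapping the two
    colours of an end moves the remaining pair to the corner [(a', b')] of [three_zeros]. *)
Lemma tcol2 (M1 M2 : seq nat) (S : seq (seq nat)) (a a' b b' : nat) :
  ulist M1 -> ulist M2 -> all ulist S -> odd (size S) -> a != a' -> b != b' ->
  0 < tcol [:: a; a'] [:: b; b'] M1 M2 S /\
  (tcol [:: a; a'] [:: b; b'] M1 M2 S <= 1 -> bad [:: a; a'] [:: b; b'] M1 M2 S).
Proof.
move=> u1 u2 uS oS aa bb; rewrite /tcol !(big_cons, big_nil) !addn0.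
pose X x y := pcol x [:: M1] y; pose Y x y := pcol x [:: M2] y; pose Z x y := pcol x S y.
rewrite -!/(X _ _) -!/(Y _ _) -!/(Z _ _).
have zX : zmat X by apply: pcol_zmat; rewrite /= ?u1.
have zY : zmat Y by apply: pcol_zmat; rewrite /= ?u2.
have zZ : zmat Z by exact: pcol_zmat.
have dX x y : X x y = 0 -> x != y by exact: pcol1_diag.
have dY x y : Y x y = 0 -> x != y by exact: pcol1_diag.
have three x x' y y' := @three_zeros X Y Z x x' y y' zX zY zZ dX dY.
have tobad x x' y y' : perm_eq [:: a; a'] [:: x; x'] -> perm_eq [:: b; b'] [:: y; y'] ->
    zbad X Y Z x x' y y' -> bad [:: a; a'] [:: b; b'] M1 M2 S.
  by move=> pA pB /(bad_of_zbad u1 u2); exact: bad_perm.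
have sw (x y : nat) : perm_eq [:: x; y] [:: y; x] by apply/permP => P /=; lia.
have := three a a' b b'; have := three a a' b' b; have := three a' a b b'.
have := three a' a b' b.
rewrite (eq_sym a' a) (eq_sym b' b) aa bb.
move: (tobad a a' b b') (tobad a a' b' b) (tobad a' a b b') (tobad a' a b' b).
rewrite !sw !perm_refl.
move: (X a b * _ * _) (X a b' * _ * _) (X a' b * _ * _) (X a' b' * _ * _) => p1 p2 p3 p4.
move=> t1 t2 t3 t4 /(_ isT isT) h1 /(_ isT isT) h2 /(_ isT isT) h3 /(_ isT isT) h4.
split=> [|le1].
  rewrite lt0n; apply/negP => /eqP sum0.
  have [q1 q2 q3 q4] : [/\ p1 = 0, p2 = 0, p3 = 0 & p4 = 0] by split; lia.
  by case: (h4 q1 q2 q3); rewrite q4.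
case: (posnP p1) => q1; case: (posnP p2) => q2; case: (posnP p3) => q3; try lia.
- by apply: t1 => //; apply: (h4 q1 q2 q3).2; lia.
- by apply: t2 => //; apply: (h3 q2 q1 _).2; lia.
- by apply: t3 => //; apply: (h2 q3 _ q1).2; lia.
- by apply: t4 => //; apply: (h1 _ q3 q2).2; lia.
Qed.

Lemma bad_count (A B M1 M2 : seq nat) (S : seq (seq nat)) :
  bad A B M1 M2 S -> count (mem B) A = 1 /\ count (mem A) B = 1.
Proof.
case=> k [x [y [ukxy pA pB _ _]]].
move: ukxy; rewrite (permP pA) (permP pB) /= !(perm_mem pA) !(perm_mem pB) !inE.
by split; lia.
Qed.

Lemma tcol_ulist (A B M1 M2 : seq nat) (S : seq (seq nat)) :
  ulist A -> ulist B -> ulist M1 -> ulist M2 -> all ulist S -> odd (size S) ->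
  0 < tcol A B M1 M2 S /\ (tcol A B M1 M2 S <= 1 -> bad A B M1 M2 S).
Proof.
move=> uA uB u1 u2 uS oS.
have sub A' B' : subseq A' A -> subseq B' B -> tcol A' B' M1 M2 S <= tcol A B M1 M2 S.
  move=> hA hB; apply: leq_tcol => //.
  by elim: (S) => //= s S' ->; rewrite subseq_refl.
have tc a a' b b' : subseq [:: a; a'] A -> subseq [:: b; b'] B ->
    0 < tcol A B M1 M2 S /\
    (tcol A B M1 M2 S <= 1 -> bad [:: a; a'] [:: b; b'] M1 M2 S).
  move=> hA hB; have le := sub _ _ hA hB.
  have aa : a != a'.
    by case/andP: uA => /(subseq_uniq hA) /=; rewrite inE andbT.
  have bb : b != b'.
    by case/andP: uB => /(subseq_uniq hB) /=; rewrite inE andbT.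
  have [pos le1] := tcol2 u1 u2 uS oS aa bb.
  by split=> [|h]; [exact: leq_trans pos le|apply: le1; exact: leq_trans le h].
have [a [a' [A' eA]]] : exists a a' A', A = [:: a, a' & A'].
  by case: (A) uA => [|a [|a' A']] // _; exists a, a', A'.
have [b [b' [B' eB]]] : exists b b' B', B = [:: b, b' & B'].
  by case: (B) uB => [|b [|b' B']] // _; exists b, b', B'.
have pre2 (x y : nat) s : subseq [:: x; y] [:: x, y & s] by rewrite /= !eqxx sub0seq.
have [|| pos _] := tc a a' b b'; rewrite ?eA ?eB //.
rewrite -eA -eB in pos *; split=> // le1.
have tb x x' y y' hx hy := (tc x x' y y' hx hy).2 le1.
have three (x y z : nat) s : [/\ subseq [:: x; y] [:: x, y, z & s],
    subseq [:: x; z] [:: x, y, z & s] & subseq [:: y; z] [:: x, y, z & s]].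
  split; first exact: pre2.
    by apply: (@cat_subseq _ [:: x] [:: z] [:: x]); rewrite ?subseq_refl ?sub1seq ?inE ?eqxx ?orbT.
  exact: subseq_trans (pre2 _ _ _) (subseq_cons _ x).
(* With a third colour in [A], each of three pairs from [A] would be bad and share exactly one
   colour with [[:: b; b']]; the three pairs together count every shared colour twice, so the total
   cannot be 3. *)
have A0 : A' = [::].
  case: A' eA => // a'' A' eA; have [s1 s2 s3] := three a a' a'' A'; rewrite -eA in s1 s2 s3.
  have sB : subseq [:: b; b'] B by rewrite eB.
  have [+ _] := bad_count (tb _ _ _ _ s1 sB); have [+ _] := bad_count (tb _ _ _ _ s2 sB).
  have [+ _] := bad_count (tb _ _ _ _ s3 sB); rewrite /= !addn0.
  by do 3 case: (_ \in [:: b; b']).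
have B0 : B' = [::].
  case: B' eB => // b'' B' eB; have [s1 s2 s3] := three b b' b'' B'; rewrite -eB in s1 s2 s3.
  have sA : subseq [:: a; a'] A by rewrite eA.
  have [_ +] := bad_count (tb _ _ _ _ sA s1); have [_ +] := bad_count (tb _ _ _ _ sA s2).
  have [_ +] := bad_count (tb _ _ _ _ sA s3); rewrite /= !addn0.
  by do 3 case: (_ \in [:: a; a']).
by have := tb a a' b b'; rewrite eA eB A0 B0 !subseq_refl; apply.
Qed.

(** * The join with 3-lists *)

Definition del (c : nat) (s : seq nat) : seq nat := [seq x <- s | x != c].

Lemma size_del (n c : nat) (s : seq nat) : nlist n s -> size (del c s) + (c \in s) = n.
Proof. by case/andP=> us /eqP <-; rewrite size_filter count_predC1. Qed.

Lemma ulist_del (c : nat) (s : seq nat) : nlist 3 s -> ulist (del c s).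
Proof.
move=> hs; have := size_del c hs; case/andP: hs => us _; rewrite /ulist filter_uniq //=.
by case: (c \in s); lia.
Qed.

Lemma all_ulist_del (c : nat) (S : seq (seq nat)) :
  all (nlist 3) S -> all ulist [seq del c s | s <- S].
Proof. by move=> /allP hS; apply/allP => _ /mapP[s /hS hs ->]; exact: ulist_del. Qed.

Lemma del_perm (c x y : nat) (s : seq nat) :
  nlist 3 s -> perm_eq (del c s) [:: x; y] -> perm_eq s [:: c; x; y].
Proof.
move=> hs p; have cs : c \in s.
  by have := size_del c hs; rewrite (perm_size p); case: (c \in s).
have us : uniq s by case/andP: hs.
by apply: perm_trans (perm_to_rem cs) _; rewrite rem_filter // perm_cons.
Qed.

(* Use [c] on the odd positions of the path. *)
Lemma pcol_alternate (c d x y : nat) (S : seq (seq nat)) :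
  all (nlist 3) S -> all (fun s => c \in s) S -> odd (size S) ->
  d != c -> x != c -> y != c -> 0 < pcol x [seq del d s | s <- S] y.
Proof.
move=> + + + dc + yc; move: (leqnn (size S)); move: {2}(size S) => n.
elim: n S x => [|n IH] [|s [|t S]] //= x.
  move=> _ /andP[hs _] /andP[cs _] _ xc; rewrite -/(pcol x [:: del d s] y) pcol1_count -has_count.
  by apply/hasP; exists c; rewrite ?mem_filter ?cs; lia.
rewrite ltnS => sn /and3P[hs ht hS] /and3P[cs ct cS]; rewrite negbK => oS xc.
have [z /[!mem_filter] /andP[zd zt] zc] := ulist_other c (ulist_del d ht).
have pz : 0 < pcol z [seq del d s | s <- S] y by apply: IH => //; lia.
have cd : c \in del d s by rewrite mem_filter eq_sym dc.
rewrite (big_rem c) //= eq_sym xc addn_gt0; apply/orP; left.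
rewrite (big_rem z) /=; last by rewrite mem_filter zd.
by rewrite zc addn_gt0 pz.
Qed.

Lemma pcol1_size3 (M : seq nat) (a b : nat) : nlist 3 M -> 0 < pcol a [:: M] b.
Proof. by move=> hM; rewrite (pcol1E _ _ hM). Qed.

Lemma distinct_eqF (a b e f : nat) : uniq [:: a; b; e; f] ->
  (((a == b) = false) * ((b == a) = false) * ((a == e) = false) * ((e == a) = false) *
   ((a == f) = false) * ((f == a) = false) * ((b == e) = false) * ((e == b) = false) *
   ((b == f) = false) * ((f == b) = false) * ((e == f) = false) * ((f == e) = false))%type.
Proof. by rewrite /= !inE => v; do !split; lia. Qed.

(* Below, [c] is the apex colour of a bad assignment with parameters [k], [x], [y];
   the lists are those left when another apex colour is deleted. *)
Section Compensation.

Variables (c k x y : nat) (T : seq (seq nat)).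
Hypotheses (u : uniq [:: c; k; x; y]) (uT : all ulist T).

Lemma row_pos2 (a b b' : nat) : b != b' -> 0 < pcol a T b + pcol a T b'.
Proof.
move=> bb; rewrite lt0n; apply/negP; rewrite addn_eq0 => /andP[/eqP h /eqP h'].
by rewrite (pcol_row0 uT h h') eqxx in bb.
Qed.

Lemma col_pos2 (a a' b : nat) : a != a' -> 0 < pcol a T b + pcol a' T b.
Proof.
move=> aa; rewrite lt0n; apply/negP; rewrite addn_eq0 => /andP[/eqP h /eqP h'].
by rewrite (pcol_col0 uT h h') eqxx in aa.
Qed.

(** The case of [x] deleted and [M2] equal to [[:: c; k; y]]: row [k] has at most one zero among its
    three entries, and row [c] contributes once more. *)
Lemma comp_x1 : 3 <= tcol [:: c; k] [:: c; k; y] [:: c; y] [:: c; k; y] T.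
Proof.
have eqF := distinct_eqF u.
have := @row_pos2 c c k; have := @row_pos2 k c k; have := @row_pos2 k c y; have := @row_pos2 k k y.
rewrite /tcol !(big_cons, big_nil) !pcol1_count /= !eqF !eqxx /=.
move=> /(_ isT) + /(_ isT) + /(_ isT) + /(_ isT).
lia.
Qed.

(** Only the end pairs [(c, c)], [(k, k)] and [(k, y)] extend to both middle vertices, in 1, 2 and 1
    ways; the last two give the bound once their path counts are positive, which [pcol_alternate]
    ensures. *)
Lemma comp_x2 : 0 < pcol k T k -> 0 < pcol k T y ->
  3 <= tcol [:: c; k] [:: c; k; y] [:: c; y] [:: c; k] T.
Proof.
have eqF := distinct_eqF u.
rewrite /tcol !(big_cons, big_nil) !pcol1_count /= !eqF !eqxx /=; lia.
Qed.

Lemma comp_y1 : 3 <= tcol [:: c; k; x] [:: c; k] [:: c; x] [:: c; k; x] T.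
Proof.
have eqF := distinct_eqF u.
have := @col_pos2 c k c; have := @col_pos2 c k k; have := @col_pos2 c x k; have := @col_pos2 k x k.
rewrite /tcol !(big_cons, big_nil) !pcol1_count /= !eqF !eqxx /=.
move=> /(_ isT) + /(_ isT) + /(_ isT) + /(_ isT).
lia.
Qed.

Lemma comp_y2 : 0 < pcol k T k -> 0 < pcol x T k ->
  3 <= tcol [:: c; k; x] [:: c; k] [:: c; x] [:: c; k] T.
Proof.
have eqF := distinct_eqF u.
rewrite /tcol !(big_cons, big_nil) !pcol1_count /= !eqF !eqxx /=; lia.
Qed.

Lemma comp_other (M1 M2 : seq nat) : nlist 3 M1 -> nlist 3 M2 ->
  3 <= tcol [:: c; k; x] [:: c; k; y] M1 M2 T.
Proof.
move=> h1 h2; have eqF := distinct_eqF u.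
apply: (@leq_trans (\sum_(a <- [:: c; k; x]) \sum_(b <- [:: c; k; y]) pcol a T b)).
  have := @row_pos2 c c k; have := @row_pos2 k c k; have := @row_pos2 x c k.
  rewrite !eqF /= !(big_cons, big_nil) => /(_ isT) + /(_ isT) + /(_ isT); lia.
apply: leq_sum => a _; apply: leq_sum => b _.
by rewrite leq_pmull // muln_gt0 !pcol1_size3.
Qed.

End Compensation.

Definition del_tcol (c : nat) (A B M1 M2 : seq nat) (S : seq (seq nat)) : nat :=
  tcol (del c A) (del c B) (del c M1) (del c M2) [seq del c s | s <- S].

Lemma compensation (c k x y d : nat) (A B M1 M2 : seq nat) (S : seq (seq nat)) :
  uniq [:: c; k; x; y] -> all (nlist 3) S -> odd (size S) -> all (fun s => c \in s) S ->
  perm_eq A [:: c; k; x] -> perm_eq B [:: c; k; y] -> perm_eq M1 [:: c; x; y] ->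
  (perm_eq M2 [:: c; k; y] \/ perm_eq M2 [:: c; k; x]) -> d != c -> d != k ->
  3 <= del_tcol d A B M1 M2 S.
Proof.
move=> u hS oS cS pA pB p1 p2 dc dk.
have delP s t : perm_eq s t -> perm_eq (del d s) (del d t) by exact: perm_filter.
have uT : all ulist [seq del d s | s <- S] by exact: all_ulist_del.
have eqF := distinct_eqF u.
have alt x' y' : x' != c -> y' != c -> 0 < pcol x' [seq del d s | s <- S] y'.
  exact: pcol_alternate.
have kc : k != c by rewrite eqF.
have xc : x != c by rewrite eqF.
have yc : y != c by rewrite eqF.
rewrite /del_tcol (tcol_perm _ (delP _ _ pA) (delP _ _ pB) (delP _ _ p1) (perm_refl _)).
case: (d =P x) => [dx|/eqP dx].
  subst d; case: p2 => p2;
    rewrite (tcol_perm _ (perm_refl _) (perm_refl _) (perm_refl _) (delP _ _ p2));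
    rewrite /del /= !eqF !eqxx /=.
  - exact: comp_x1 u uT.
  - by apply: (comp_x2 u uT); apply: alt.
case: (d =P y) => [dy|/eqP dy].
  subst d; case: p2 => p2;
    rewrite (tcol_perm _ (perm_refl _) (perm_refl _) (perm_refl _) (delP _ _ p2));
    rewrite /del /= !eqF !eqxx /=.
  - by apply: (comp_y2 u uT); apply: alt.
  - exact: comp_y1 u uT.
have dcF : (c == d) = false by rewrite eq_sym (negPf dc).
have dkF : (k == d) = false by rewrite eq_sym (negPf dk).
have dxF : (x == d) = false by rewrite eq_sym (negPf dx).
have dyF : (y == d) = false by rewrite eq_sym (negPf dy).
rewrite {1 2 3}/del /= !(dcF, dkF, dxF, dyF) /=; apply: comp_other u uT _ _ _ _.
  by rewrite /nlist /= !inE !eqF.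
case: p2 => /delP p2; rewrite /nlist (perm_uniq p2) (perm_size p2);
  by rewrite /del /= !(dcF, dkF, dxF, dyF) /= !inE !eqF.
Qed.

(** Since [k] is missing from a middle list, this statement applied to [k] itself shows that
    deleting [k] leaves at least two colourings. *)
Lemma del_tcol_bad (c : nat) (A B M1 M2 : seq nat) (S : seq (seq nat)) :
  nlist 3 A -> nlist 3 B -> nlist 3 M1 -> nlist 3 M2 -> all (nlist 3) S -> odd (size S) ->
  0 < del_tcol c A B M1 M2 S /\
  (del_tcol c A B M1 M2 S <= 1 ->
     [/\ c \in M1, c \in M2 & exists2 k, k != c &
       (k \notin M1) || (k \notin M2) /\
       (forall d, d != c -> d != k -> 3 <= del_tcol d A B M1 M2 S)]).
Proof.
move=> hA hB h1 h2 hS oS.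
have [] := tcol_ulist (ulist_del c hA) (ulist_del c hB) (ulist_del c h1) (ulist_del c h2)
  (all_ulist_del c hS); first by rewrite size_map.
move=> pos le1; split=> // /le1[k [x [y [ukxy pA pB S0 hM]]]].
have {}pA := del_perm hA pA; have {}pB := del_perm hB pB.
have uA : uniq [:: c; k; x] by rewrite -(perm_uniq pA); case/andP: hA.
have uB : uniq [:: c; k; y] by rewrite -(perm_uniq pB); case/andP: hB.
have u : uniq [:: c; k; x; y].
  move: ukxy uA uB; rewrite /= !inE !negb_or !andbT.
  by move=> /andP[/andP[-> ->] ->] /andP[/andP[-> ->] _] /andP[/andP[_ ->] _].
have eqF := distinct_eqF u.
(* A vanishing path count forces every remaining list to have exactly two colours, so each 3-list of
   the path has lost [c]. *)
have cS : all (fun s => c \in s) S.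
  apply/allP => s sS; have /allP/(_ _ sS) hs := hS.
  have := pcol0_size (all_ulist_del c hS) S0; rewrite all_map => /allP/(_ _ sS) /= /eqP.
  by have := size_del c hs; case: (c \in s) => //; rewrite addn0 => ->.
have [{}hM|{}hM] :
    (perm_eq M1 [:: c; x; y] /\
      (perm_eq M2 [:: c; k; y] \/ perm_eq M2 [:: c; k; x])) \/
    (perm_eq M2 [:: c; x; y] /\
      (perm_eq M1 [:: c; k; y] \/ perm_eq M1 [:: c; k; x])).
- by case: hM => -[/del_perm p /= [/del_perm q|/del_perm q]]; [left|left|right|right]; split; auto.
- case: hM => p q; split; first by rewrite (perm_mem p) !inE eqxx.
    by case: q => q; rewrite (perm_mem q) !inE eqxx.
  exists k; first by rewrite eqF.
  split; first by rewrite (perm_mem p) !inE !eqF.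
  by move=> d; exact: (compensation u).
- case: hM => p q; split; last 1 first.
  + exists k; first by rewrite eqF.
    split; first by rewrite orbC (perm_mem p) !inE !eqF.
    by move=> d; rewrite /del_tcol tcolC; exact: (compensation u).
  + by case: q => q; rewrite (perm_mem q) !inE eqxx.
  + by rewrite (perm_mem p) !inE eqxx.
Qed.

(** The value 6 is three apex colours times two colourings. If [c] leaves only one, [k] leaves at
    least two and any other colour at least three, so the worst total is 1 + 2 + 3. *)
Lemma join3_ge (W A B M1 M2 : seq nat) (S : seq (seq nat)) :
  nlist 3 W -> nlist 3 A -> nlist 3 B -> nlist 3 M1 -> nlist 3 M2 ->
  all (nlist 3) S -> odd (size S) -> 6 <= \sum_(c <- W) del_tcol c A B M1 M2 S.
Proof.
move=> hW hA hB h1 h2 hS oS.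
have db c := del_tcol_bad c hA hB h1 h2 hS oS.
pose F c := del_tcol c A B M1 M2 S; change (6 <= \sum_(c <- W) F c).
case: (boolP (has (fun c => F c <= 1) W)) => [/hasP[c cW Fc]|/hasPn F2]; last first.
  apply: (@leq_trans (\sum_(c <- W) 2)); last first.
    by apply: leq_sum_in => c /F2; rewrite -ltnNge.
  by rewrite big_const_seq iter_addn_0 count_predT; case/andP: hW => _ /eqP ->.
have [Fpos /(_ Fc) [cM1 cM2 [k kc [kM F3]]]] := db c.
have Fk : 2 <= F k.
  rewrite ltnNge; apply/negP => Fk; have [_ /(_ Fk) [kM1 kM2 _]] := db k.
  by rewrite kM1 kM2 in kM.
have pW := perm_to_rem cW; rewrite (perm_big _ pW) big_cons.
have : nlist 2 (rem c W).
  by case/andP: hW => uW /eqP sW; rewrite /nlist rem_uniq // size_rem // sW.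
have : c \notin rem c W by rewrite mem_rem_uniq ?inE ?eqxx //; case/andP: hW.
case: (rem c W) => [|d [|e [|z s]]] cde; rewrite /nlist /= ?andbF // !inE !andbT => de.
rewrite !big_cons big_nil.
have Fd z : z != c -> 2 + (z != k) <= F z.
  by move=> zc; case: (z =P k) => [->//|/eqP zk]; exact: F3.
move: cde; rewrite !inE !negb_or => /andP[cd ce].
have := Fd d; have := Fd e; rewrite (eq_sym e c) ce (eq_sym d c) cd => /(_ isT) + /(_ isT).
have : 0 < (d != k) + (e != k).
  by case: (d =P k) de => [->|//]; rewrite eq_sym => ->.
move: Fpos; rewrite -/(F c); clear; move: (F c) (F d) (F e).
by case: (d != k); case: (e != k); lia.
Qed.

(** * Reduction of the graph to the counting functions *)

(** List colourings as sequences in vertex order, so that the dependent functions of [P_list] can be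
    counted by recursion on the lists. *)
Fixpoint choices (Ls : seq (seq nat)) : seq (seq nat) :=
  if Ls is s :: Ls' then [seq x :: t | x <- s, t <- choices Ls'] else [:: [::]].

Lemma count_choices_cons (P : pred (seq nat)) (s : seq nat) (Ls : seq (seq nat)) :
  count P (choices (s :: Ls)) = \sum_(x <- s) count (fun t => P (x :: t)) (choices Ls).
Proof.
rewrite /= count_flatten sumnE !big_map.
by apply: eq_bigr => x _; rewrite count_map.
Qed.

Lemma mem_choices (Ls : seq (seq nat)) (t : seq nat) :
  (t \in choices Ls) = (size t == size Ls) && all2 (fun x s => x \in s) t Ls.
Proof.
elim: Ls t => [|s Ls IH] [|x t] //=.
- by apply/negbTE/negP => /allpairsP[[y u] /= [_ _]].
- rewrite eqSS andbCA -IH; apply/allpairsP/andP => [[[y u] /= [ys ut [-> ->]]]|[xs ts]] //.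
  by exists (x, t).
Qed.

Lemma uniq_choices (Ls : seq (seq nat)) : all uniq Ls -> uniq (choices Ls).
Proof.
elim: Ls => //= s Ls IH /andP[us /IH uL].
by apply: allpairs_uniq => // -[x t] [y u] _ _ [-> ->].
Qed.

Arguments choices : simpl never.

Lemma count_choices_del (c : nat) (P : pred (seq nat)) (Ls : seq (seq nat)) :
  count (fun t => all (fun x => x != c) t && P t) (choices Ls) =
  count P (choices [seq del c s | s <- Ls]).
Proof.
elim: Ls P => [|s Ls IH] P //; rewrite map_cons !count_choices_cons.
rewrite big_filter [RHS]big_mkcond; apply: eq_bigr => x _ /=.
case: (x != c); last by rewrite (eq_count (a2 := pred0)) ?count_pred0.
exact: IH.
Qed.

Lemma count_choices_path (a b : nat) (S : seq (seq nat)) :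
  count (fun t => path (fun x y => x != y) a (rcons t b)) (choices S) = pcol a S b.
Proof.
elim: S a => [|s S IH] a; first by rewrite /choices /= andbT addn0.
rewrite count_choices_cons /= [RHS]big_mkcond; apply: eq_bigr => x _ /=.
rewrite eq_sym; case: (x != a) => /=; first exact: IH.
by rewrite (eq_count (a2 := pred0)) ?count_pred0.
Qed.

(** Positions follow the numbering of [Theta 2 2 (2 * k)]: ends 0 and 1, middle vertices 2 and 3,
    inner vertices of the long path from 4 on. *)
Definition theta_ok (t : seq nat) : bool :=
  if t is a :: b :: y1 :: y2 :: xs then
    [&& y1 != a, y1 != b, y2 != a, y2 != b & path (fun x y => x != y) a (rcons xs b)]
  else false.

Definition join_ok (t : seq nat) : bool :=
  if t is c :: t' then all (fun x => x != c) t' && theta_ok t' else false.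

Lemma count_theta_ok (A B M1 M2 : seq nat) (S : seq (seq nat)) :
  count theta_ok (choices [:: A, B, M1, M2 & S]) = tcol A B M1 M2 S.
Proof.
rewrite count_choices_cons; apply: eq_bigr => a _.
rewrite count_choices_cons; apply: eq_bigr => b _.
rewrite count_choices_cons !pcol1_count -!sum_count -mulnA big_distrl /=.
apply: eq_bigr => y1 _; rewrite big_distrl big_distrr /= count_choices_cons.
apply: eq_bigr => y2 _; rewrite -count_choices_path.
case: (y1 != a) (y1 != b) (y2 != a) (y2 != b) => [] [] [] [] /=;
  by rewrite ?mul1n ?mul0n ?muln0 ?count_pred0.
Qed.

Lemma count_join_ok (W A B M1 M2 : seq nat) (S : seq (seq nat)) :
  count join_ok (choices [:: W, A, B, M1, M2 & S]) =
  \sum_(c <- W) del_tcol c A B M1 M2 S.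
Proof.
rewrite count_choices_cons; apply: eq_bigr => c _.
by rewrite /del_tcol -count_theta_ok -(count_choices_del _ _ [:: A, B, M1, M2 & S]).
Qed.

Lemma card_coded (F : finType) (D : {set F}) (code : F -> seq nat) (Q : seq (seq nat)) :
  uniq Q -> injective code -> (forall f, f \in D -> code f \in Q) ->
  (forall t, t \in Q -> exists2 f, f \in D & code f = t) -> #|D| = size Q.
Proof.
move=> uQ inj sub sur; rewrite cardE -(size_map code).
apply/perm_size/uniq_perm => //; first by rewrite map_inj_uniq ?enum_uniq.
move=> t; apply/mapP/idP => [[f]|/sur[f fD <-]]; last by exists f; rewrite ?mem_enum.
by rewrite mem_enum => /sub + ->.
Qed.

Definition proper (H : graph) (t : seq nat) : bool :=
  [forall x : 'I_(gn H), forall y : 'I_(gn H), gadj x y ==> (nth 0 t x != nth 0 t y)].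

Lemma nth_map_ord (n : nat) (T : Type) (x0 : T) (g : 'I_n -> T) (v : 'I_n) :
  nth x0 [seq g w | w <- enum 'I_n] v = g v.
Proof. by rewrite (nth_map v) ?size_enum_ord // nth_ord_enum. Qed.

Lemma mem_choices_ord (n : nat) (L : 'I_n -> seq nat) (t : seq nat) :
  reflect (size t = n /\ forall v : 'I_n, nth 0 t v \in L v)
    (t \in choices [seq L v | v <- enum 'I_n]).
Proof.
rewrite mem_choices size_map size_enum_ord.
apply: (iffP andP) => -[st h].
  move/eqP: st => st; split=> // v; move: h; rewrite all2E size_map size_enum_ord st eqxx /= => /allP.
  move=> /(_ (nth 0 t v, L v)) /=; apply.
  rewrite -(nth_map_ord [::] L v) -nth_zip; last by rewrite size_map size_enum_ord.
  by rewrite mem_nth // size_zip size_map size_enum_ord st minnn.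
rewrite st eqxx; split=> //.
rewrite all2E size_map size_enum_ord st eqxx /=; apply/(all_nthP (0, [::])) => i.
rewrite size_zip size_map size_enum_ord st minnn => lt_in.
rewrite nth_zip /=; last by rewrite size_map size_enum_ord.
by have := h (Ordinal lt_in); rewrite -(nth_map_ord [::] L).
Qed.

Lemma P_listE (H : graph) (L : 'I_(gn H) -> seq nat) : (forall v, uniq (L v)) ->
  P_list H L = count (proper H) (choices [seq L v | v <- enum 'I_(gn H)]).
Proof.
move=> uL; rewrite -size_filter /P_list.
apply: (card_coded (code := fun f : {dffun forall v : 'I_(gn H), seq_sub (L v)} =>
  [seq val (f v) | v <- enum 'I_(gn H)])).
- by rewrite filter_uniq // uniq_choices // all_map; apply/allP => v _ /=.
- move=> f g fg; apply/ffunP => v; apply: val_inj.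
  by rewrite -(nth_map_ord 0 (fun v => val (f v))) fg nth_map_ord.
- move=> f; rewrite inE mem_filter => /forallP hf; apply/andP; split.
    apply/forallP => x; apply/forallP => y; rewrite !nth_map_ord.
    by have /forallP := hf x; apply.
  apply/mem_choices_ord; rewrite size_map size_enum_ord; split=> // v.
  by rewrite nth_map_ord; exact: (valP (f v)).
move=> t; rewrite mem_filter => /andP[pt /mem_choices_ord[st ht]].
pose f : {dffun forall v : 'I_(gn H), seq_sub (L v)} := [ffun v => SeqSub (ht v)].
have ev v : val (f v) = nth 0 t v by rewrite ffunE.
exists f.
  rewrite inE; apply/forallP => x; apply/forallP => y; rewrite !ev.
  by have /forallP/(_ x)/forallP := pt; apply.
apply: (@eq_from_nth _ 0); rewrite size_map size_enum_ord ?st // => i lt_in.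
by rewrite (nth_map_ord 0 (fun v => val (f v)) (Ordinal lt_in)) ev.
Qed.

Lemma P_chromE (H : graph) (m : nat) : P_chrom H m = P_list H (fun=> iota 0 m).
Proof.
rewrite P_listE => [|v]; last exact: iota_uniq.
rewrite -size_filter /P_chrom.
apply: (card_coded (code := fun f : {ffun 'I_(gn H) -> 'I_m} =>
  [seq val (f v) | v <- enum 'I_(gn H)])).
- by rewrite filter_uniq // uniq_choices // all_map; apply/allP => v _ /=; exact: iota_uniq.
- move=> f g fg; apply/ffunP => v; apply: val_inj.
  by rewrite -(nth_map_ord 0 (fun v => val (f v))) fg nth_map_ord.
- move=> f; rewrite inE mem_filter => /forallP hf; apply/andP; split.
    apply/forallP => x; apply/forallP => y; rewrite !nth_map_ord.
    by have /forallP := hf x; apply.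
  apply/mem_choices_ord; rewrite size_map size_enum_ord; split=> // v.
  by rewrite nth_map_ord mem_iota /=.
move=> t; rewrite mem_filter => /andP[pt /mem_choices_ord[st ht]].
have lt_m (v : 'I_(gn H)) : nth 0 t v < m by have := ht v; rewrite mem_iota.
pose f : {ffun 'I_(gn H) -> 'I_m} := [ffun v => Ordinal (lt_m v)].
have ev v : val (f v) = nth 0 t v by rewrite ffunE.
exists f.
  rewrite inE; apply/forallP => x; apply/forallP => y.
  by have /forallP/(_ x)/forallP/(_ y) := pt; rewrite -!ev.
apply: (@eq_from_nth _ 0); rewrite size_map size_enum_ord ?st // => i lt_in.
by rewrite (nth_map_ord 0 (fun v => val (f v)) (Ordinal lt_in)) ev.
Qed.

Lemma proper_join1 (H : graph) (c : nat) (t : seq nat) : size t = gn H ->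
  proper (join1 H) (c :: t) = all (fun x => x != c) t && proper H t.
Proof.
move=> st; apply/forallP/andP => [h|[/allP hc /forallP h]].
  have {}h x y : @gadj (join1 H) x y -> nth 0 (c :: t) x != nth 0 (c :: t) y.
    by have /forallP/(_ y)/implyP := h x.
  split.
    apply/(all_nthP 0) => i; rewrite st => lt_i.
    have := h (lift ord0 (Ordinal lt_i)) ord0.
    by rewrite /= liftK unlift_none /=; apply.
  apply/forallP => x; apply/forallP => y; apply/implyP => xy.
  by have := h (lift ord0 x) (lift ord0 y); rewrite /= !liftK /=; apply.
have hca (a : 'I_(gn H)) : nth 0 t a != c by rewrite hc // mem_nth // st.
move=> x; apply/forallP => y; apply/implyP; rewrite /=.
case: (unliftP ord0 x) => [a|] ->; case: (unliftP ord0 y) => [b|] -> //=.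
- by move=> ab; have /forallP/(_ b)/implyP/(_ ab) := h a.
- by move=> _; exact: hca.
- by move=> _; rewrite eq_sym; exact: hca.
Qed.

Lemma all_consec (e : rel nat) (x : nat) (s : seq nat) :
  all (fun p => e p.1 p.2) (consec (x :: s)) = path e x s.
Proof. by rewrite /consec /=; elim: s x => //= y s IH x; rewrite IH. Qed.

(** Edges are pairs of natural numbers; the range condition excludes pairs that the right-hand side
    would test but that join no vertices of the graph. *)
Lemma proper_Theta (l1 l2 l3 : nat) (t : seq nat) :
  all (fun e => (e.1 < l1 + l2 + l3 - 1) && (e.2 < l1 + l2 + l3 - 1))
    (theta_edges l1 l2 l3) ->
  proper (Theta l1 l2 l3) t =
  all (fun e => nth 0 t e.1 != nth 0 t e.2) (theta_edges l1 l2 l3).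
Proof.
move=> /allP lt_e; apply/forallP/allP => [h [i j] ij|h x] /=.
  have /andP[/= lti ltj] := lt_e _ ij.
  by have /forallP/(_ (Ordinal ltj))/implyP := h (Ordinal lti); apply; rewrite /= ij.
apply/forallP => y; apply/implyP => /orP[/h //|/h]; by rewrite eq_sym.
Qed.

Lemma nth_iota_drop (xs : seq nat) (p : seq nat) :
  [seq nth 0 (p ++ xs) i | i <- iota (size p) (size xs)] = xs.
Proof.
rewrite -[size p]addn0 iotaDl -map_comp; apply: (@eq_from_nth _ 0).
  by rewrite size_map size_iota.
move=> i; rewrite size_map size_iota => lt_i.
by rewrite (nth_map 0) ?size_iota // nth_iota //= add0n nth_cat ltnNge leq_addr /= addKn.
Qed.

Lemma path_all2 (P : pred nat) (x : nat) (s : seq nat) :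
  all P (x :: s) -> path (fun i j => P i && P j) x s.
Proof. by elim: s x => //= y s IH x /and3P[-> Py Ps]; rewrite Py IH //= Py. Qed.

Lemma proper_Theta22 (k : nat) (t : seq nat) : 0 < k -> size t = 2 + 2 + 2 * k - 1 ->
  proper (Theta 2 2 (2 * k)) t = theta_ok t.
Proof.
move=> k0 st; rewrite proper_Theta; last first.
  pose P i := i < 2 + 2 + 2 * k - 1.
  rewrite /theta_edges !all_cat !(all_consec (fun i j => P i && P j)) -!/(_ ++ _).
  have [P0 P1 P2 P3] : [/\ P 0, P 1, P 2 & P 3] by rewrite /P; split; lia.
  rewrite !path_all2 //= ?P0 ?P1 ?P2 ?P3 // all_rcons P1.
  by apply/allP => i; rewrite mem_iota /P; lia.
case: t st => [|a [|b [|y1 [|y2 xs]]]] st; try by move: st => /=; lia.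
have sx : size xs = (2 * k).-1 by move: st => /=; lia.
rewrite /theta_edges !all_cat.
have -> : consec (path_seq 2 2.-1) = [:: (0, 2); (2, 1)] by [].
have -> : consec (path_seq (2 + 1) 2.-1) = [:: (0, 3); (3, 1)] by [].
pose h := nth 0 [:: a, b, y1, y2 & xs].
rewrite (all_consec (fun i j => h i != h j)) -sx.
rewrite -[path _ 0 _](path_map (f := h) (e' := fun x y => x != y)) map_rcons.
rewrite (nth_iota_drop xs [:: a; b; y1; y2]) /= !andbT.
by rewrite (eq_sym a y1) (eq_sym a y2) !andbA.
Qed.

(** The long path has [2 k - 1 = 2 (k - 1) + 1] inner vertices, so the index of [sval] is
    [k - 1]. *)
Lemma P_list_join_Theta (k : nat) (L : 'I_(gn (join1 (Theta 2 2 (2 * k)))) -> seq nat) :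
  0 < k -> (forall v, uniq (L v)) ->
  exists W A B M1 M2 S,
  [/\ [seq L v | v <- enum 'I_(gn (join1 (Theta 2 2 (2 * k))))] = [:: W, A, B, M1, M2 & S],
    size S = k.-1.*2.+1 &
    P_list _ L = \sum_(c <- W) del_tcol c A B M1 M2 S].
Proof.
move=> k0 uL; rewrite P_listE //.
set Ls := [seq L v | v <- _].
have sLs : size Ls = (2 + 2 + 2 * k - 1).+1 by rewrite size_map size_enum_ord.
case: Ls sLs (erefl Ls) => [|W [|A [|B [|M1 [|M2 S]]]]] sLs eLs; try by move: sLs => /=; lia.
exists W, A, B, M1, M2, S; split=> //; first by move: sLs => /=; lia.
rewrite -count_join_ok; apply: eq_in_count => t; rewrite mem_choices sLs => /andP[/eqP st _].
case: t st => [|c t] // [st].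
by rewrite proper_join1 //= proper_Theta22.
Qed.

(** * Equal lists and the list color function *)

Lemma pcol_const (p j : nat) (s : seq nat) (S : seq (seq nat)) (a b : nat) :
  nlist p.+2 s -> all (pred1 s) S -> size S = j.*2.+1 -> a \in s -> b \in s ->
  pcol a S b = sval p j + (a == b).
Proof.
move=> hs; elim: j S a b => [|j IH] S a b.
  case: S => [|s' [|]] //= /andP[/eqP -> _] _ as_ bs; rewrite -/(pcol a [:: s] b).
  by rewrite (pcol1E _ _ hs) as_ bs /= muln0; lia.
case: S => [|s1 [|s2 S]] // /and3P[/eqP -> /eqP -> hS] /=; rewrite doubleS => -[sS] as_ bs.
rewrite -/(pcol a [:: s, s & S] b) pcol2.
have us : uniq s by case/andP: hs.
(* The expansion of [(p + (y == a)) * (sval p j + (y == b))], separated so that [sum_pick] evaluates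
   each indicator. *)
rewrite (eq_big_seq (fun y => p * sval p j + (y == b) * p +
    ((y == a) * sval p j + (y == a) * (y == b)))); last first.
  move=> y ys; rewrite (pcol1E _ _ hs) as_ ys (IH _ _ _ hS sS ys bs) (eq_sym a y).
  by case: (y == a); case: (y == b); rewrite /= ?muln0; lia.
rewrite !big_split /= big_const_seq iter_addn_0 count_predT.
have -> : size s = p.+2 by case/andP: hs => _ /eqP.
rewrite (sum_pick (fun=> p)) // (sum_pick (fun=> sval p j)) //.
rewrite (sum_pick (fun y => y == b : nat)) // as_ bs -mulnn; lia.
Qed.

Lemma tcol_const (p j : nat) (s : seq nat) (S : seq (seq nat)) :
  nlist p.+2 s -> all (pred1 s) S -> size S = j.*2.+1 ->
  tcol s s s s S = tval p (sval p j).
Proof.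
move=> hs hS sS; rewrite /tcol.
have us : uniq s by case/andP: hs.
have ss : size s = p.+2 by case/andP: hs => _ /eqP.
have row a : a \in s ->
    \sum_(b <- s) pcol a [:: s] b * pcol a [:: s] b * pcol a S b =
    p.+1 ^ 2 * (sval p j + 1) + p.+1 * p ^ 2 * sval p j.
  move=> as_.
  rewrite (eq_big_seq (fun b => p ^ 2 * sval p j +
      (b == a) * ((2 * p + 1) * sval p j + p.+1 ^ 2))); last first.
    move=> b bs; rewrite (pcol1E _ _ hs) as_ bs (pcol_const hs hS sS) // eq_sym.
    by case: (b == a); rewrite /= -?mulnn; lia.
  by rewrite big_split /= big_const_seq iter_addn_0 count_predT ss sum_pick // as_ -!mulnn; lia.
by rewrite (eq_big_seq _ row) big_const_seq iter_addn_0 count_predT ss /tval mulnC.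
Qed.

(** A list without [c] keeps [p + 3] colours after the deletion; truncating it to [p + 2] can only
    lose colourings, so [theta_ge] applies. *)
Lemma del_tcol_ge (p j c : nat) (A B M1 M2 : seq nat) (S : seq (seq nat)) : 0 < p ->
  nlist p.+3 A -> nlist p.+3 B -> nlist p.+3 M1 -> nlist p.+3 M2 ->
  all (nlist p.+3) S -> size S = j.*2.+1 ->
  tval p (sval p j) <= del_tcol c A B M1 M2 S.
Proof.
move=> p0 hA hB h1 h2 hS sS.
have hd s : nlist p.+3 s -> nlist p.+2 (take p.+2 (del c s)).
  move=> hs; have := size_del c hs; case/andP: hs => us _ sd.
  rewrite /nlist take_uniq ?filter_uniq // size_takel ?eqxx //.
  by move: sd; case: (c \in s); lia.
apply: (@leq_trans (tcol (take p.+2 (del c A)) (take p.+2 (del c B)) (take p.+2 (del c M1))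
   (take p.+2 (del c M2)) [seq take p.+2 (del c s) | s <- S])).
  apply: theta_ge; rewrite ?size_map ?hd //.
  by rewrite all_map; apply/allP => s /(allP hS) /= /hd.
apply: leq_tcol; rewrite ?take_subseq //.
by elim: (S) => //= s S' ->; rewrite take_subseq.
Qed.

(** Each apex colour leaves equal lists of size [m - 1]; with fewer than two colours left the edges
    of the theta graph cannot be properly coloured. *)
Lemma P_chrom_join_Theta (k m : nat) : 0 < k ->
  P_chrom (join1 (Theta 2 2 (2 * k))) m =
  if m is p.+3 then m * tval p (sval p k.-1) else 0.
Proof.
move=> k0; rewrite P_chromE.
have [|W [A [B [M1 [M2 [S [eL sS ->]]]]]]] :=
  @P_list_join_Theta k (fun=> iota 0 m) k0; first by move=> v; exact: iota_uniq.
have : all (pred1 (iota 0 m)) [:: W, A, B, M1, M2 & S].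
  by rewrite -eL all_map; apply/allP => v _ /=.
rewrite /= => /and5P[/eqP -> /eqP -> /eqP -> /eqP -> /andP[/eqP -> hS]].
have hm : nlist m (iota 0 m) by rewrite /nlist iota_uniq size_iota /=.
have hdel c : c \in iota 0 m -> size (del c (iota 0 m)) = m.-1.
  by move=> cm; have := size_del c hm; rewrite cm; lia.
case: m hS hm hdel {eL} => [|[|[|p]]] hS hm hdel.
- by rewrite big_nil.
- rewrite big1_seq // => c /andP[_ /hdel]; rewrite /del_tcol.
  by case: (del c _) => // _; rewrite /tcol big_nil.
- rewrite big1_seq // => c /andP[_ /hdel]; rewrite /del_tcol.
  case: (del c _) => [|x [|]] // _; rewrite /tcol !big_seq1.
  by rewrite [pcol x [:: [:: x]] x]pcol1_count /= eqxx.
rewrite (eq_big_seq (fun=> tval p (sval p k.-1))); last first.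
  move=> c cm; rewrite /del_tcol; apply: tcol_const; rewrite ?size_map //.
    by rewrite /nlist hdel // filter_uniq ?iota_uniq /=.
  by rewrite all_map; apply/allP => s /(allP hS) /= /eqP ->.
by rewrite big_const_seq iter_addn_0 count_predT size_iota mulnC.
Qed.

Theorem theorem28 : forall k : nat, 0 < k ->
  enum_chrom_choosable (join1 (Theta 2 2 (2 * k))).
Proof.
move=> k k0 m _; split=> [|L hL].
  exists (fun=> iota 0 m); last by rewrite P_chromE.
  by move=> v; rewrite iota_uniq size_iota.
rewrite P_chrom_join_Theta //; case: m hL => [|[|[|p]]] // hL.
have [|W [A [B [M1 [M2 [S [eL sS ->]]]]]]] := @P_list_join_Theta k L k0.
  by move=> v; case: (hL v).
have : all (nlist p.+3) [:: W, A, B, M1, M2 & S].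
  by rewrite -eL all_map; apply/allP => v _ /=; rewrite /nlist; case: (hL v) => -> ->; rewrite eqxx.
rewrite /= => /and5P[hW hA hB h1 /andP[h2 hS]].
case: (posnP p) => [p0|p0].
  rewrite p0 in hW hA hB h1 h2 hS *.
  (* At [p = 0] the right-hand side is then [3 * tval 0 0], which computes to 6. *)
  have -> : sval 0 k.-1 = 0 by elim: (k.-1) => //= j ->.
  by apply: join3_ge; rewrite ?sS //= odd_double.
case/andP: (hW) => _ /eqP <-; apply: sum_const_ge => c.
exact: del_tcol_ge.
Qed.
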